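(* Let $M,N\in\mathbb{N}\cup\{\infty\}$. For any matrix $A\in\mathcal{A}_{M,N}$, there exists a stair-shaped matrix $B\in\mathcal{A}_{M,N}$ such that $A\cong B$.
   Context: $\mathcal{A}_{M,N}$ is the collection of all $M\times N$ matrices with non-negative real entries ($M$ and $N$ may be countably infinite). $A\in\mathcal{A}_{M,N}$ is stair-shaped if there exist two non-decreasing sequences of positive integers $(r_k)_{k=1}^{M+N-1}$ and $(c_k)_{k=1}^{M+N-1}$, with $r_k\le M$, $c_k\le N$ and $r_k+c_k=k+1$ for every $k$ (so $(r_1,c_1)=(1,1)$ and, when $M,N$ are finite, $(r_{M+N-1},c_{M+N-1})=(M,N)$), such that all entries of $A$ not located in the positions $(r_k,c_k)$ are zero. If $M$ or $N$ is infinite the sequences are infinite. For $1\le i_1<i_2\le M$ and $1\le j_1<j_2\le N$, the elementary matrix $E[(i_1,j_1),(i_2,j_2)]$ is the $M\times N$ matrix with $1$ at entries $(i_1,j_1)$ and $(i_2,j_2)$, $-1$ at entries $(i_1,j_2)$ and $(i_2,j_1)$, and $0$ at all other entries. For $A,B\in\mathcal{A}_{M,N}$, $A\cong B$ means that there exist real numbers $\{t_k\}_{k=1}^K$ and elementary matrices $\{E_k\}_{k=1}^K$, for some $K\in\mathbb{N}\cup\{\infty\}$, with $B=A+\sum_{k=1}^K t_kE_k$ (entrywise convergence when $K=\infty$). *)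

(* Defs.v *)
From HB Require Import structures.
From mathcomp Require Import all_boot all_order all_algebra.
From mathcomp Require Import all_classical all_reals all_analysis.
Set Implicit Arguments.
Unset Strict Implicit.
Unset Printing Implicit Defensive.
Import Order.TTheory GRing.Theory Num.Theory.
Import numFieldNormedType.Exports.
Local Open Scope classical_set_scope.
Local Open Scope ring_scope.

(* A dimension in {1, 2, ...} together with infinity: [None] stands for
   infinity, and [dim_pos] rules out [Some 0]. *)
Definition dimension := option nat.

Definition dim_pos (M : dimension) : bool := if M is Some m then (0 < m)%N else true.

Definition below (i : nat) (M : dimension) : bool :=
  if M is Some m then (i < m)%N else true.

(* Indices are counted from 0, as for ordinals: {0, ..., m - 1} or all of nat. *)
Definition index_of (M : dimension) := {i : nat | below i M}.

Definition nat_of_index (M : dimension) (i : index_of M) : nat := sval i.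
Coercion nat_of_index : index_of >-> nat.

Definition xmatrix (R : Type) (M N : dimension) := index_of M -> index_of N -> R.

Definition nonneg_mx (R : realType) (M N : dimension) (A : xmatrix R M N) : Prop :=
  forall i j, 0 <= A i j.

(* M + N - 1 *)
Definition stair_length (M N : dimension) : dimension :=
  match M, N with
  | Some m, Some n => Some (m + n - 1)%N
  | _, _ => None
  end.

(* Since the indices k, r k and c k all start at 0, the one-based condition
   r_k + c_k = k + 1 reads r k + c k = k. *)
Definition stair_shaped (R : realType) (M N : dimension) (A : xmatrix R M N) : Prop :=
  exists (r : index_of (stair_length M N) -> index_of M)
         (c : index_of (stair_length M N) -> index_of N),
    [/\ (forall k l : index_of (stair_length M N), (k <= l)%N -> (r k <= r l)%N),
        (forall k l : index_of (stair_length M N), (k <= l)%N -> (c k <= c l)%N),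
        (forall k : index_of (stair_length M N), (r k + c k)%N = k :> nat) &
        forall i j, ~ (exists k, i = r k /\ j = c k) -> A i j = 0].

Definition elementary_mx (R : realType) (M N : dimension)
    (i1 i2 : index_of M) (j1 j2 : index_of N) : xmatrix R M N :=
  fun i j =>
    if ((i == i1 :> nat) && (j == j1 :> nat))
       || ((i == i2 :> nat) && (j == j2 :> nat)) then 1
    else if ((i == i1 :> nat) && (j == j2 :> nat))
            || ((i == i2 :> nat) && (j == j1 :> nat)) then -1
    else 0.

Definition is_elementary (R : realType) (M N : dimension) (E : xmatrix R M N) : Prop :=
  exists (i1 i2 : index_of M) (j1 j2 : index_of N),
    [/\ (i1 < i2)%N, (j1 < j2)%N & E = elementary_mx R i1 i2 j1 j2].

(* The finite case includes the empty sum: when M = 1 or N = 1 there are no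
   elementary matrices, and the relation is then equality. In the infinite case
   the partial sums are taken in the given order; absolute convergence is not
   required. *)
Definition mx_cong (R : realType) (M N : dimension) (A B : xmatrix R M N) : Prop :=
  (exists (K : nat) (t : 'I_K -> R) (E : 'I_K -> xmatrix R M N),
     (forall k, is_elementary (E k)) /\
     forall i j, B i j = A i j + \sum_(k < K) t k * E k i j)
  \/
  (exists (t : nat -> R) (E : nat -> xmatrix R M N),
     (forall k, is_elementary (E k)) /\
     forall i j,
       A i j + \sum_(0 <= k < n) t k * E k i j @[n --> \oo] --> B i j).

(* Main.v *)
Require Import Defs.
From mathcomp Require Import all_boot all_order all_algebra.
From mathcomp Require Import all_classical all_reals all_analysis.
From mathcomp Require Import lra zify.
Set Implicit Arguments.
Unset Strict Implicit.
Unset Printing Implicit Defensive.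
Import Order.TTheory GRing.Theory Num.Theory.
Import numFieldNormedType.Exports.
Local Open Scope classical_set_scope.
Local Open Scope ring_scope.

(** An elementary matrix has zero line sums, so congruence preserves every line
    sum that is a finite sum. As soon as [M] and [N] are at least [2], nothing
    else is preserved ([cong_of_totals]): two matrices are congruent whenever
    their column sums agree in case [M] is finite, and their row sums agree in
    case [N] is finite. Since only entrywise convergence is required, an
    infinite sum of elementary matrices can push the discrepancy along an
    infinite dimension to infinity. Concretely, the positions are corrected one
    at a time: to correct the entry [(i, j)], add a multiple of an elementary
    matrix on the rows [i, i'] and the columns [j, j'], where [i'] is row [0] if
    [M] is finite and a row beyond all positions corrected before if [M] is
    infinite, and likewise for [j']. No earlier correction is spoiled, so each
    position outside of row [0] (for finite [M]) and column [0] (for finite [N])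
    is eventually right for good; the line sums then force the entries of these
    two lines to be eventually right as well.

    It remains to find a non-negative stair-shaped matrix with prescribed finite
    line sums. A matrix is stair-shaped as soon as its support is a chain for
    the product order ([chain_stair_shaped]): walk from the corner, going right
    only if the support still has something to the right in the current row. If
    both dimensions are finite, place consecutive intervals whose lengths are
    the row sums, and over the same segment consecutive intervals whose lengths
    are the column sums; the lengths of the pairwise overlaps form the required
    matrix, which is the one that the northwest corner rule produces
    ([northwest]). If only [M] is finite, put the column sums in row [0]; if
    only [N] is finite, put the row sums in column [0]; if neither is, the zero
    matrix does ([chain_with_totals]). When [M] or [N] is [1], every matrix is
    stair-shaped already. *)

(** * Line sums *)

Lemma index_inj M : injective (@nat_of_index M).
Proof. by move=> i j eq_ij; apply: val_inj. Qed.

Definition ord_index n (j : 'I_n) : index_of (Some n) := exist _ (val j) (ltn_ord j).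

Lemma ord_indexP n (j : index_of (Some n)) : exists o, j = ord_index o.
Proof. by case: j => j hj; exists (Ordinal hj); apply: index_inj. Qed.

Section Totals.
Variable R : realType.

(** The value [0] for an infinite dimension makes an equality of totals void
    there, so that one statement about totals covers finite and infinite
    dimensions together. *)
Definition total N : (index_of N -> R) -> R :=
  match N with
  | Some n => fun f => \sum_(j < n) f (ord_index j)
  | None => fun=> 0
  end.

Lemma total_linear N (f g : index_of N -> R) a :
  total (fun j => f j + a * g j) = total f + a * total g.
Proof.
case: N f g => [n|] f g /=; last by rewrite mulr0 addr0.
by rewrite big_split mulr_sumr.
Qed.

Lemma eq_total N (f g : index_of N -> R) : f =1 g -> total f = total g.
Proof. by move=> /funext ->. Qed.

Lemma total_ge0 N (f : index_of N -> R) : (forall j, 0 <= f j) -> 0 <= total f.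
Proof. by case: N f => [n|] f f0 //=; apply: sumr_ge0. Qed.

Lemma total_indicator N (j1 j2 : index_of N) :
  total (fun j : index_of N => (j == j1 :> nat)%:R) =
  total (fun j : index_of N => (j == j2 :> nat)%:R).
Proof.
have one n (i : index_of (Some n)) :
    total (fun j : index_of (Some n) => (j == i :> nat)%:R) = 1.
  have [x ->] := ord_indexP i; rewrite /= (bigD1 x) //= eqxx big1 ?addr0 // => l.
  by rewrite -val_eqE /= => /negbTE ->.
by case: N j1 j2 => [n|] j1 j2 //; rewrite !one.
Qed.

Lemma total_head n (n_gt0 : (0 < n)%N) (f : index_of (Some n) -> R) :
  (forall j : index_of (Some n), j != 0%N :> nat -> f j = 0) ->
  total f = f (ord_index (Ordinal n_gt0)).
Proof.
move=> f0; rewrite /= (bigD1 (Ordinal n_gt0)) //= big1 ?addr0 // => l l_neq0.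
by apply: f0; move: l_neq0; rewrite -val_eqE.
Qed.

(** * Elementary matrices *)

(** The rank one form of an elementary matrix, from which both its zero line
    sums and its symmetry under transposition can be read off. *)
Lemma elementary_mxE M N (i1 i2 : index_of M) (j1 j2 : index_of N) i j :
  (i1 < i2)%N -> (j1 < j2)%N ->
  elementary_mx R i1 i2 j1 j2 i j =
  ((i == i1 :> nat)%:R - (i == i2 :> nat)%:R) *
  ((j == j1 :> nat)%:R - (j == j2 :> nat)%:R).
Proof.
move=> lt_i lt_j; rewrite /elementary_mx.
have [ei1|_] := eqVneq (i : nat) i1; have [ei2|_] := eqVneq (i : nat) i2;
have [ej1|_] := eqVneq (j : nat) j1; have [ej2|_] := eqVneq (j : nat) j2;
  rewrite /=; solve [lia | lra].
Qed.

Lemma total_row_elementary M N (E : xmatrix R M N) i :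
  is_elementary E -> total (E i) = 0.
Proof.
move=> [i1 [i2 [j1 [j2 [lt_i lt_j ->]]]]].
set a : R := (i == i1 :> nat)%:R - (i == i2 :> nat)%:R.
rewrite (@eq_total _ _ (fun j =>
  (fun j' : index_of N => 0 + a * (j' == j1 :> nat)%:R) j
  + (- a) * (j == j2 :> nat)%:R)); last first.
  by move=> j; rewrite elementary_mxE // add0r mulrBr mulNr.
rewrite total_linear (total_linear (fun=> 0)) (total_indicator j1 j2) mulNr addrK.
by case: {+}N => //= n; rewrite big1.
Qed.

Lemma elementary_tr M N (E : xmatrix R M N) :
  is_elementary E -> is_elementary (fun j i => E i j).
Proof.
move=> [i1 [i2 [j1 [j2 [lt_i lt_j ->]]]]]; exists j1, j2, i1, i2; split=> //.
by apply/funext => j; apply/funext => i; rewrite !elementary_mxE // mulrC.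
Qed.

Lemma total_col_elementary M N (E : xmatrix R M N) j :
  is_elementary E -> total (E^~ j) = 0.
Proof. by move=> /elementary_tr /total_row_elementary. Qed.

(** * Correcting the entries one at a time *)

(** The pivots are the lines that can be corrected freely; in a finite dimension
    line [0] is kept to absorb the corrections of the others. *)
Definition pivot M (i : index_of M) : bool := if M is Some _ then (0 < i)%N else true.

(** On a finite line, the entry at [0] is minus the sum of finitely many entries
    that are all eventually zero. *)
Lemma eventually_zero_line N (g : nat -> index_of N -> R) :
  (forall n, total (g n) = 0) ->
  (forall j, pivot j -> \forall n \near \oo, g n j = 0) ->
  forall j, \forall n \near \oo, g n j = 0.
Proof.
case: N g => [n|] g g0 gp j; last exact: gp.
have [j_gt0|j_eq0] := boolP (0 < j)%N; first exact: gp.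
have [x ej] := ord_indexP j; subst j.
have : \forall k \near \oo, forall l : 'I_n, l != x -> g k (ord_index l) = 0.
  apply: filter_forall => l; have [->|ne_lx] := eqVneq l x.
    by near=> k.
  near=> k => _; near: k; apply: gp => /=.
  by move: ne_lx j_eq0; rewrite -val_eqE /nat_of_index /=; lia.
apply: filterS => k gk; have := g0 k.
by rewrite /= (bigD1 x) //= big1 ?addr0 // => l /gk.
Unshelve. all: end_near. Qed.

(** The second line [i'] of a correction. In a finite dimension it is [0], which
    is not a pivot; in an infinite one it lies beyond [b], a bound on the
    lines of the earlier corrections. *)
Lemma exists_partner M (i : index_of M) (b : nat) : pivot i ->
  exists2 i' : index_of M, i' != i :> nat &
    forall y : index_of M, pivot y -> (y <= b)%N -> y != i' :> nat.
Proof.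
case: M i => [m|] i piv_i.
  have m0 : (0 < m)%N by case: i piv_i => i; rewrite /= => im _; apply: leq_trans im.
  exists (exist _ 0%N m0 : index_of (Some m)); rewrite /nat_of_index /=.
    by rewrite eq_sym -lt0n.
  by move=> y; rewrite /pivot lt0n.
exists (exist _ (maxn i b).+1 isT : index_of None); rewrite {1}/nat_of_index /=.
  by rewrite gtn_eqF // ltnS leq_maxl.
by move=> y _ le_yb; rewrite ltn_eqF // ltnS leq_max le_yb orbT.
Qed.

(** The two lines of a correction come in no particular order, whereas those of
    an elementary matrix are increasing; hence [E i j] may be [-1]. *)
Lemma elementary_through M N (i i' : index_of M) (j j' : index_of N) :
  i' != i :> nat -> j' != j :> nat ->
  exists E : xmatrix R M N, [/\ is_elementary E, E i j != 0 &
    forall (y : index_of M) (z : index_of N),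
      y != i' :> nat -> z != j' :> nat -> E y z != 0 -> y = i /\ z = j].
Proof.
move=> ni nj.
pose i1 := if (i < i')%N then i else i'; pose i2 := if (i < i')%N then i' else i.
pose j1 := if (j < j')%N then j else j'; pose j2 := if (j < j')%N then j' else j.
have lt_i : (i1 < i2)%N by rewrite /i1 /i2; case: (ltngtP i i') ni => // ->; rewrite eqxx.
have lt_j : (j1 < j2)%N by rewrite /j1 /j2; case: (ltngtP j j') nj => // ->; rewrite eqxx.
have ni' : (i == i' :> nat) = false by rewrite eq_sym (negbTE ni).
have nj' : (j == j' :> nat) = false by rewrite eq_sym (negbTE nj).
exists (elementary_mx R i1 i2 j1 j2); split; first by exists i1, i2, j1, j2.
  rewrite elementary_mxE // /i1 /i2 /j1 /j2 mulf_neq0 //.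
    by case: ltnP; rewrite eqxx ni' ?subr0 ?sub0r ?oppr_eq0 oner_eq0.
  by case: ltnP; rewrite eqxx nj' ?subr0 ?sub0r ?oppr_eq0 oner_eq0.
move=> y z ny nz; rewrite elementary_mxE // mulf_eq0 negb_or => /andP[y0 z0].
split; apply: index_inj; apply/eqP; [move: y0 | move: z0]; apply: contraNT => /negbTE.
  by rewrite /i1 /i2; case: ltnP => _ ->; rewrite (negbTE ny) subrr.
by rewrite /j1 /j2; case: ltnP => _ ->; rewrite (negbTE nz) subrr.
Qed.

(** What is left of [D] after the first [n] corrections, the [k]-th of which
    clears the entry at [p k] with a multiple of [E k]. *)
Fixpoint residual M N (p : nat -> index_of M * index_of N)
    (E : nat -> xmatrix R M N) (D : xmatrix R M N) n : xmatrix R M N :=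
  if n is k.+1 then
    let G := residual p E D k in
    fun i j => G i j + - (G (p k).1 (p k).2 / E k (p k).1 (p k).2) * E k i j
  else D.

(** The system is triangular: [E k] vanishes at the positions treated before
    [k]. Positions are allowed to repeat, as clearing one again does no harm. *)
Lemma residual_eq0 M N (p : nat -> index_of M * index_of N)
    (E : nat -> xmatrix R M N) D n k :
  (forall k, E k (p k).1 (p k).2 != 0) ->
  (forall l k, (l < k)%N -> p l <> p k -> E k (p l).1 (p l).2 = 0) ->
  (k < n)%N -> residual p E D n (p k).1 (p k).2 = 0.
Proof.
move=> E_p E_lt; elim: n => // n IHn; rewrite ltnS leq_eqVlt /= => /predU1P[->|lt_kn].
  by rewrite mulNr divfK // subrr.
have [->|ne] := pselect (p k = p n); first by rewrite mulNr divfK // subrr.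
by rewrite IHn // (E_lt k) // mulr0 addr0.
Qed.

Lemma enum_positions M N (P : index_of M -> index_of N -> Prop) i0 j0 : P i0 j0 ->
  exists p : nat -> index_of M * index_of N,
    (forall k, P (p k).1 (p k).2) /\ (forall i j, P i j -> exists k, p k = (i, j)).
Proof.
move=> P0.
pose q k : index_of M * index_of N := odflt (i0, j0)
  (@unpickle ({i | below i M} * {j | below j N})%type k).
exists (fun k => if `[< P (q k).1 (q k).2 >] then q k else (i0, j0)); split.
  by move=> k; case: asboolP.
move=> i j Pij.
exists (@pickle ({i | below i M} * {j | below j N})%type (i, j)).
have -> : q (@pickle ({i | below i M} * {j | below j N})%type (i, j)) = (i, j).
  by rewrite /q pickleK.
by rewrite asboolT.
Qed.

(** Finite and infinite dimensions are treated alike, so even two finite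
    matrices get an infinite sequence of corrections: their residual is
    eventually zero. *)
Lemma cong_of_totals M N (A B : xmatrix R M N) :
  below 1 M -> below 1 N ->
  (forall i, total (A i) = total (B i)) ->
  (forall j, total (A^~ j) = total (B^~ j)) ->
  mx_cong A B.
Proof.
move=> M_gt1 N_gt1 rowAB colAB.
have piv1 L (L1 : below 1 L) : pivot (exist _ 1%N L1 : index_of L) by case: L L1.
have [p [p_piv p_surj]] := @enum_positions M N (fun i j => pivot i /\ pivot j)
  _ _ (conj (piv1 _ M_gt1) (piv1 _ N_gt1)).
have exE k : exists E : xmatrix R M N, [/\ is_elementary E, E (p k).1 (p k).2 != 0 &
    forall l, (l < k)%N -> p l <> p k -> E (p l).1 (p l).2 = 0].
  have [i' ni far_i] := exists_partner (\max_(l < k) (p l).1)%N (p_piv k).1.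
  have [j' nj far_j] := exists_partner (\max_(l < k) (p l).2)%N (p_piv k).2.
  have [E [E_el E_p E_sub]] := elementary_through ni nj.
  exists E; split=> // l lt_lk ne; apply/eqP; apply: contraPT ne => E_l; apply: contrapT.
  have [||e1 e2] := E_sub _ _ _ _ E_l; last first.
  - by apply; rewrite [p l]surjective_pairing e1 e2 -surjective_pairing.
  - apply: far_j; first exact: (p_piv l).2.
    by rewrite (leq_bigmax (Ordinal lt_lk)).
  - apply: far_i; first exact: (p_piv l).1.
    by rewrite (leq_bigmax (Ordinal lt_lk)).
have {exE}[E /all_and3[E_el E_p E_lt]] := choice exE.
pose D : xmatrix R M N := fun i j => B i j - A i j.
pose G := residual p E D.
have G_piv i j : pivot i -> pivot j -> \forall n \near \oo, G n i j = 0.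
  move=> pi pj; have [k ek] := p_surj i j (conj pi pj).
  have [-> ->] : i = (p k).1 /\ j = (p k).2 by rewrite ek.
  by exists k.+1 => // n /= lt_kn; apply: residual_eq0 => // l m lt_lm; apply: E_lt.
have G_row n i : total (G n i) = 0.
  elim: n => [|n IHn]; last first.
    by rewrite /G /= total_linear -/(G n) IHn (total_row_elementary _ (E_el n)) mulr0 addr0.
  rewrite /G /= (@eq_total _ _ (fun j => B i j + (-1) * A i j)).
    by rewrite total_linear rowAB mulN1r subrr.
  by move=> j; rewrite mulN1r.
have G_col n j : total ((G n)^~ j) = 0.
  elim: n => [|n IHn]; last first.
    by rewrite /G /= total_linear -/(G n) IHn (total_col_elementary _ (E_el n)) mulr0 addr0.
  rewrite /G /= (@eq_total _ _ (fun i => B i j + (-1) * A i j)).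
    by rewrite total_linear colAB mulN1r subrr.
  by move=> i; rewrite mulN1r.
(* First along the pivot rows, whose entries are pivots except possibly one;
   then along the columns, in which all pivot rows are now known. *)
have G_pivrow i j : pivot i -> \forall n \near \oo, G n i j = 0.
  by move=> pi; apply: (eventually_zero_line (G_row^~ i)) => j'; apply: G_piv.
have G0 i j : \forall n \near \oo, G n i j = 0.
  by apply: (eventually_zero_line (G_col^~ j)) => i'; apply: G_pivrow.
right; exists (fun k => G k (p k).1 (p k).2 / E k (p k).1 (p k).2), E; split=> // i j.
set S := (X in X @ _ --> _).
have SE n : S n = B i j - G n i j.
  rewrite /S; elim: n => [|n IHn]; first by rewrite big_geq // addr0 subKr.
  rewrite big_nat_recr //= addrA IHn /G /= opprD addrA.
  by rewrite mulNr opprK.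
apply: (@cvg_near_cst _ _ _ _ _); near=> n.
rewrite SE (_ : G n i j = 0) ?subr0 //; near: n; exact: G0.
Unshelve. all: end_near. Qed.

(** * Matrices supported on a chain *)

Definition chain_support M N (A : xmatrix R M N) : Prop :=
  forall i i' j j', A i j != 0 -> A i' j' != 0 -> (i < i')%N -> (j <= j')%N.

(** Go down whenever the rest of the current row is empty. The conditions with
    [below] keep the path inside the matrix: it goes right along the last row,
    and down along the last column. *)
Fixpoint greedy_path M N (A : xmatrix R M N) (k : nat) : nat * nat :=
  if k is k'.+1 then
    let: (a, b) := greedy_path A k' in
    if below a.+1 M &&
       (~~ below b.+1 N ||
        `[< forall (i : index_of M) (j : index_of N), i = a :> nat -> (b < j)%N -> A i j = 0 >])
    then (a.+1, b) else (a, b.+1)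
  else (0, 0)%N.

Lemma greedy_path_sum M N (A : xmatrix R M N) k :
  ((greedy_path A k).1 + (greedy_path A k).2 = k)%N.
Proof. by elim: k => //= k; case: greedy_path => a b /=; case: ifP => _ /=; lia. Qed.

Lemma greedy_path_mono M N (A : xmatrix R M N) k l : (k <= l)%N ->
  ((greedy_path A k).1 <= (greedy_path A l).1)%N /\
  ((greedy_path A k).2 <= (greedy_path A l).2)%N.
Proof.
elim: l => [|l IHl]; first by rewrite leqn0 => /eqP ->.
rewrite leq_eqVlt => /predU1P[-> //|/IHl] /=.
by case: (greedy_path A l) => a b /=; case: ifP => _ /=; lia.
Qed.

Lemma greedy_path_below M N (A : xmatrix R M N) k :
  dim_pos M -> dim_pos N -> below k (stair_length M N) ->
  below (greedy_path A k).1 M /\ below (greedy_path A k).2 N.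
Proof.
move=> M0 N0; elim: k => [|k IHk] hk; first by case: M N M0 N0 hk A => [?|] [?|].
have {IHk}[] : below (greedy_path A k).1 M /\ below (greedy_path A k).2 N.
  by apply: IHk; case: M N hk {M0 N0 A} => [m|] [n|] //=; apply: ltnW.
have := greedy_path_sum A k; rewrite /=; case: (greedy_path A k) => a b /= ab aM bN.
case: ifP => [/andP[]//|]; case b1: (below b.+1 N) => //=.
rewrite andbT => a1.
by case: M N hk {M0 N0 A} aM bN b1 a1 => [m|] [n|] //=; lia.
Qed.

(** A support position cannot be left behind. Going down from [(a, b)] leaves
    nothing to the right in row [a]. Going right while a lower row exists means
    that row [a] has a support position to the right, and then the chain
    condition forbids one below in column [b]. *)
Lemma greedy_path_covers M N (A : xmatrix R M N) i j k :
  chain_support A -> A i j != 0 ->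
  (exists2 l, (l < k)%N & greedy_path A l = (i : nat, j : nat)) \/
  ((greedy_path A k).1 <= i)%N /\ ((greedy_path A k).2 <= j)%N.
Proof.
move=> chA Aij; elim: k => [|k [[l lk e]|]]; [by right | by left; exists l => //; lia |].
rewrite /=; case e: (greedy_path A k) => [a b] /= [ai bj].
have [[ia jb]|ne] := pselect (i = a :> nat /\ j = b :> nat).
  by left; exists k; rewrite ?e ?ia ?jb.
right; case: ifP => [/andP[_ right_empty]|stay] /=.
  split=> //; rewrite ltn_neqAle ai andbT; apply/eqP => ea; apply: ne; split=> //.
  apply/eqP; rewrite eqn_leq bj andbT leqNgt; apply/negP => lt_bj.
  case/orP: right_empty => [|/asboolP /(_ i j)]; last first.
    by move=> A0; move: Aij; rewrite A0 ?eqxx.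
  by case: j Aij lt_bj {bj} => j; case: N A chA e => //= n *; lia.
split=> //; rewrite ltn_neqAle bj andbT; apply/eqP => eb; apply: ne; split=> //.
apply/eqP; rewrite eqn_leq ai andbT leqNgt; apply/negP => lt_ai.
have a1 : below a.+1 M.
  by case: i Aij lt_ai {ai} => i; case: M A chA e stay => //= m *; lia.
move: stay; rewrite a1 /= => /negbT; rewrite negb_or => /andP[_ /asboolPn].
apply=> i' j' ei' lt_bj'; apply/eqP; apply: contraT => A'.
by have := chA _ _ _ _ A' Aij; rewrite ei' => /(_ lt_ai); lia.
Qed.

(** At time [i + j] the path is on the antidiagonal of [(i, j)], where the only
    position below both coordinates is [(i, j)] itself; so the path meets every
    support position, and infinite dimensions need no separate argument. *)
Lemma chain_stair_shaped M N (A : xmatrix R M N) :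
  dim_pos M -> dim_pos N -> chain_support A -> stair_shaped A.
Proof.
move=> M0 N0 chA.
pose inside (k : index_of (stair_length M N)) := greedy_path_below A M0 N0 (svalP k).
pose r (k : index_of (stair_length M N)) : index_of M := exist _ (greedy_path A k).1 (inside k).1.
pose c (k : index_of (stair_length M N)) : index_of N := exist _ (greedy_path A k).2 (inside k).2.
exists r, c; split.
- by move=> k l /(greedy_path_mono A)[].
- by move=> k l /(greedy_path_mono A)[].
- by move=> k; apply: greedy_path_sum.
move=> i j off; apply/eqP; apply: contra_notT off => Aij.
have hk : below (i + j) (stair_length M N).
  by case: i j {Aij} => i + [j +]; rewrite /nat_of_index; case: (M) (N) => [m|] [n|] //=; lia.
have on_path : greedy_path A (i + j) = (i : nat, j : nat).
  case: (greedy_path_covers (i + j) chA Aij) => [[l lt_l e]|].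
    by have := greedy_path_sum A l; rewrite e /=; lia.
  have := greedy_path_sum A (i + j).
  by case: (greedy_path A _) => a b /= ab [ai bj]; congr pair; lia.
exists (exist _ (i + j)%N hk : index_of (stair_length M N)).
by split; apply: index_inj; rewrite /nat_of_index /= on_path.
Qed.

(** * The northwest corner matrix *)

Definition prefix_total n (f : index_of (Some n) -> R) (k : nat) : R :=
  \sum_(j < n | (j < k)%N) f (ord_index j).

Lemma prefix_total0 n (f : index_of (Some n) -> R) : prefix_total f 0 = 0.
Proof. by rewrite /prefix_total big_pred0. Qed.

Lemma prefix_total_full n (f : index_of (Some n) -> R) : prefix_total f n = total f.
Proof. by apply: eq_bigl => j; rewrite ltn_ord. Qed.

Lemma prefix_totalS n (f : index_of (Some n) -> R) (o : 'I_n) :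
  prefix_total f o.+1 = prefix_total f o + f (ord_index o).
Proof.
rewrite /prefix_total (bigD1 o) //= addrC; congr (_ + _).
by apply: eq_bigl => j; rewrite -val_eqE /=; lia.
Qed.

Lemma prefix_total_mono n (f : index_of (Some n) -> R) k l :
  (forall j, 0 <= f j) -> (k <= l)%N -> prefix_total f k <= prefix_total f l.
Proof.
move=> f0 kl; rewrite /prefix_total big_mkcond [leRHS]big_mkcond; apply: ler_sum => j _.
by case: ifP => jk; [rewrite (leq_trans jk kl) | case: ifP].
Qed.

(** The length of the intersection of the intervals [[a, b]] and [[c, d]], as
    the second difference of [min]: this form telescopes along rows and
    columns. *)
Definition overlap (a b c d : R) : R :=
  (Num.min b d - Num.min a d) - (Num.min b c - Num.min a c).

Lemma overlapC a b c d : overlap a b c d = overlap c d a b.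
Proof.
by rewrite /overlap [Num.min d b]minC [Num.min d a]minC [Num.min c b]minC
  [Num.min c a]minC; lra.
Qed.

Lemma overlap_ge0 a b c d : a <= b -> c <= d -> 0 <= overlap a b c d.
Proof.
move=> ab cd; rewrite /overlap.
by case: (leP b d); case: (leP a d); case: (leP b c); case: (leP a c); lra.
Qed.

Lemma overlap_neq0 a b c d : a <= b -> c <= d -> overlap a b c d != 0 -> c < b.
Proof.
move=> ab cd; apply: contraNT; rewrite -leNgt => bc; apply/eqP; rewrite /overlap.
by case: (leP b d); case: (leP a d); case: (leP b c); case: (leP a c); lra.
Qed.

Lemma sum_overlap n (f : nat -> R) a b :
  a <= b -> f 0%N <= a -> b <= f n ->
  \sum_(j < n) overlap a b (f j) (f j.+1) = b - a.
Proof.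
move=> ab f0a bfn.
rewrite -(big_mkord xpredT (fun j => overlap a b (f j) (f j.+1))).
rewrite (telescope_sumr (fun j => Num.min b (f j) - Num.min a (f j))) //.
rewrite (min_l bfn) (min_l (le_trans ab bfn)) (min_r f0a) (min_r (le_trans f0a ab)).
by rewrite subrr subr0.
Qed.

(** The chain condition says that intervals overlap in order: if the row
    interval [i] is to the left of [i'] and the column interval [j'] to the left
    of [j], then [i] meeting [j] and [i'] meeting [j'] would cross. *)
Lemma northwest m n (r : index_of (Some m) -> R) (c : index_of (Some n) -> R) :
  (forall i, 0 <= r i) -> (forall j, 0 <= c j) -> total r = total c ->
  exists B : xmatrix R (Some m) (Some n), [/\ nonneg_mx B, chain_support B,
    (forall i, total (B i) = r i) & (forall j, total (B^~ j) = c j)].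
Proof.
move=> r0 c0 rc; pose F := prefix_total r; pose H := prefix_total c.
have Fm k l : (k <= l)%N -> F k <= F l by apply: prefix_total_mono.
have Hm k l : (k <= l)%N -> H k <= H l by apply: prefix_total_mono.
have F0 : F 0%N = 0 by apply: prefix_total0.
have H0 : H 0%N = 0 by apply: prefix_total0.
have FH : F m = H n by rewrite /F /H !prefix_total_full.
exists (fun i j => overlap (F i) (F i.+1) (H j) (H j.+1)); split.
- by move=> i j; apply: overlap_ge0; [apply: Fm | apply: Hm].
- move=> i i' j j' Bij Bij' lt_ii'; rewrite leqNgt; apply/negP => lt_jj'.
  have HF := overlap_neq0 (Fm _ _ (leqnSn i)) (Hm _ _ (leqnSn j)) Bij.
  move: Bij'; rewrite overlapC => /(overlap_neq0 (Hm _ _ (leqnSn j')) (Fm _ _ (leqnSn i'))).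
  by have := Fm _ _ lt_ii'; have := Hm _ _ lt_jj'; lra.
- move=> i; have [x ->] := ord_indexP i; rewrite /= sum_overlap.
  + by rewrite /F prefix_totalS addrC addKr.
  + exact: Fm.
  + by rewrite H0 -F0 Fm.
  + by rewrite -FH Fm.
- move=> j; have [x ->] := ord_indexP j; rewrite /=.
  under eq_bigr do rewrite overlapC.
  rewrite sum_overlap.
  + by rewrite /H prefix_totalS addrC addKr.
  + exact: Hm.
  + by rewrite F0 -H0 Hm.
  + by rewrite FH Hm.
Qed.

(** * Stair-shaped representatives *)

Lemma chain_with_totals M N (A : xmatrix R M N) :
  dim_pos M -> dim_pos N -> nonneg_mx A ->
  exists B : xmatrix R M N, [/\ nonneg_mx B, chain_support B,
    (forall i, total (A i) = total (B i)) & (forall j, total (A^~ j) = total (B^~ j))].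
Proof.
move=> M0 N0 A0.
have row0 i : 0 <= total (A i) by apply: total_ge0 => j; apply: A0.
have col0 j : 0 <= total (A^~ j) by apply: total_ge0 => i; apply: A0.
case: M N M0 N0 A A0 row0 col0 => [m|] [n|] M0 N0 A A0 row0 col0.
- have [|B [B0 Bch Br Bc]] := northwest row0 col0; first by rewrite /= exchange_big.
  by exists B; split=> // [i|j]; rewrite ?Br ?Bc.
- exists (fun i j => if i == 0%N :> nat then total (A^~ j) else 0); split=> //.
  + by move=> i j; case: ifP.
  + by move=> i i' j j' _; case: ifP => [/eqP -> _|]; rewrite ?ltn0 ?eqxx.
  + by move=> j; rewrite [RHS](total_head M0) //= => l /negbTE ->.
- exists (fun i j => if j == 0%N :> nat then total (A i) else 0); split=> //.
  + by move=> i j; case: ifP.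
  + by move=> i i' j j'; case: ifP => [/eqP -> //|]; rewrite eqxx.
  + by move=> i; rewrite [RHS](total_head N0) //= => l /negbTE ->.
- by exists (fun _ _ => 0); split=> // i i' j j'; rewrite eqxx.
Qed.

Lemma chain_support_line M N (A : xmatrix R M N) :
  dim_pos M -> dim_pos N -> ~~ (below 1 M && below 1 N) -> chain_support A.
Proof.
move=> M0 N0 line i i' j j' _ _ lt_ii'.
case: i i' j j' lt_ii' => i + [i' +] [j +] [j' +]; rewrite /nat_of_index /=.
by case: M N M0 N0 line {A} => [m|] [n|] //=; lia.
Qed.

Lemma mx_cong_refl M N (A : xmatrix R M N) : mx_cong A A.
Proof.
left; exists 0%N, (fun=> 0), (fun=> A); split; first by case.
by move=> i j; rewrite big_ord0 addr0.
Qed.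

End Totals.

Theorem theorem6p4 (R : realType) (M N : dimension)
    (hM : dim_pos M) (hN : dim_pos N)
    (A : xmatrix R M N) (hA : nonneg_mx A) :
  exists B : xmatrix R M N,
    [/\ nonneg_mx B, stair_shaped B & mx_cong A B].
Proof.
have [/andP[M1 N1]|line] := boolP (below 1 M && below 1 N).
  have [B [B0 Bch row col]] := chain_with_totals hM hN hA.
  by exists B; split; [|apply: chain_stair_shaped|apply: cong_of_totals].
exists A; split=> //; last exact: mx_cong_refl.
by apply: chain_stair_shaped => //; apply: chain_support_line.
Qed.
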